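(* Let $m,n\in\mathbb{N}_{0}$ and let $a,b\in\mathbb{Z}$ with $a\equiv b\equiv 1 \pmod 2$. Then for all $x,y,z\in\mathbb{R}$, \begin{align*} &2b^{n}\,\mathrm{sgn}(b)\sum_{j=0}^{m}\binom{m}{j}\frac{(-1)^{j}a^{m-j}}{m+n+1-j}\,S_{j,m+n+1-j}^{(5)}\begin{pmatrix} a & 1 & b\\ y & x & z\end{pmatrix} +2a^{m}\,\mathrm{sgn}(a)\sum_{j=0}^{n}\binom{n}{j}\frac{(-1)^{j}b^{n-j}}{m+n+1-j}\,S_{j,m+n+1-j}^{(5)}\begin{pmatrix} b & 1 & a\\ z & x & y\end{pmatrix}\\ &=(-1)^{m+n}\overline{E}_{m}(ax-y)\overline{E}_{n}(bx-z) +\delta_{0,m}\delta_{0,n}\,\mathrm{sgn}(ab)\,(-1)^{ax+bx-y-z}\,\delta_{\mathbb{Z}}(ax-y)\,\delta_{\mathbb{Z}}(bx-z)\\ &\quad+\frac{(-1)^{m}\,2\,m!\,n!\,(a,b)^{m+n+2}}{a^{n+1}b^{m+1}(m+n+1)!}\,\overline{E}_{m+n+1}\!\left(\frac{az-by}{(a,b)}\right). \end{align*} (The factor $(-1)^{ax+bx-y-z}$ is only relevant when $ax-y,bx-z\in\mathbb{Z}$, in which case its exponent is an integer.)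
   Context: For real $x$, $[x]$ is the floor of $x$ and $\{x\}=x-[x]$. $E_n(x)$ denotes the Euler polynomial (generating function $\frac{2e^{xt}}{e^t+1}=\sum_{n\ge0}E_n(x)\frac{t^n}{n!}$) and $B_n(x)$ the Bernoulli polynomial ($\frac{te^{xt}}{e^t-1}=\sum_{n\ge0}B_n(x)\frac{t^n}{n!}$). Quasi-periodic Euler functions: $\overline{E}_{0}(x)=(-1)^{[x]}$ if $x\notin\mathbb{Z}$ and $\overline{E}_0(x)=0$ if $x\in\mathbb{Z}$; $\overline{E}_{n}(x)=(-1)^{[x]}E_{n}(\{x\})$ for $n\ge1$. Bernoulli functions: $\overline{B}_0(x)=1$; $\overline{B}_1(x)=((x))$, where $((x))=\{x\}-\tfrac12$ for $x\notin\mathbb{Z}$ and $((x))=0$ for $x\in\mathbb{Z}$; $\overline{B}_n(x)=B_n(\{x\})$ for $n\ge2$. Generalized Hardy–Berndt sums: for $m,n\in\mathbb{N}_0$, $a,b,c\in\mathbb{Z}$ with $c\neq0$, and $x,y,z\in\mathbb{R}$, $$S_{m,n}^{(5)}\begin{pmatrix} a & b & c\\ x & y & z\end{pmatrix}=\sum_{r=0}^{|c|-1}(-1)^{r}\,\overline{E}_{m}\!\left(\frac{a(r+z)}{c}-x\right)\overline{B}_{n}\!\left(\frac{b(r+z)}{c}-y\right).$$ $\mathrm{sgn}(x)=x/|x|$ for $x\ne0$; $\delta_{l,k}$ is the Kronecker delta; $\delta_{\mathbb{Z}}(x)=1$ if $x\in\mathbb{Z}$ and $0$ otherwise; $(a,b)$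 is the greatest common divisor of $a,b$. *)

(* Defs.v *)
From mathcomp Require Import all_boot all_order all_algebra.
From mathcomp Require Import reals.
Set Implicit Arguments. Unset Strict Implicit. Unset Printing Implicit Defensive.
Import Order.TTheory GRing.Theory Num.Theory.
Local Open Scope ring_scope.

Section Defs.
Variable R : realType.

Definition fracp (x : R) : R := x - (Num.floor x)%:~R.

(* Euler numbers e_k = E_k(0): from (e^t+1) * sum_k e_k t^k/k! = 2, i.e.
   sum_{j<=k} C(k,j) e_j + e_k = 2 [k=0]. *)
Definition euler_next (s : seq R) : R :=
  let k := size s in
  (2 * (k == 0%N)%:R - \sum_(j < k) 'C(k, j)%:R * s`_j) / 2.
Definition euler_seq (n : nat) : seq R :=
  iter n.+1 (fun s => rcons s (euler_next s)) [::].
Definition euler_num (k : nat) : R := (euler_seq k)`_k.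
(* Euler polynomial E_n(x) = sum_k C(n,k) E_k(0) x^(n-k)  (Appell sequence of
   the generating function 2 e^{xt}/(e^t+1)). *)
Definition eulerP (n : nat) (x : R) : R :=
  \sum_(k < n.+1) 'C(n, k)%:R * euler_num k * x ^+ (n - k).

(* Bernoulli numbers: from t/(e^t-1): sum_{j<=k} C(k+1,j) B_j = [k=0]. *)
Definition bern_next (s : seq R) : R :=
  let k := size s in
  ((k == 0%N)%:R - \sum_(j < k) 'C(k.+1, j)%:R * s`_j) / k.+1%:R.
Definition bern_seq (n : nat) : seq R :=
  iter n.+1 (fun s => rcons s (bern_next s)) [::].
Definition bern_num (k : nat) : R := (bern_seq k)`_k.
Definition bernP (n : nat) (x : R) : R :=
  \sum_(k < n.+1) 'C(n, k)%:R * bern_num k * x ^+ (n - k).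

Definition Ebar (n : nat) (x : R) : R :=
  if n is 0%N then (if x \is a Num.int then 0 else (-1) ^ (Num.floor x))
  else (-1) ^ (Num.floor x) * eulerP n (fracp x).

Definition Bbar (n : nat) (x : R) : R :=
  match n with
  | 0%N => 1
  | 1%N => if x \is a Num.int then 0 else fracp x - 2^-1
  | _ => bernP n (fracp x)
  end.

Definition deltaZ (x : R) : R := if x \is a Num.int then 1 else 0.

Definition S5 (m n : nat) (a b c : int) (x y z : R) : R :=
  \sum_(r < `|c|%N)
    (-1) ^+ r * Ebar m (a%:~R * (r%:R + z) / c%:~R - x)
              * Bbar n (b%:~R * (r%:R + z) / c%:~R - y).

End Defs.

(* Main.v *)
(* By quasi-periodicity the case a = b = 1 reduces to arguments in [0, 1), where it is
   an expansion of E_m(p) E_n(q) in products E_j(p - q) B_k; the defect there is an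
   Appell sequence in m, antiperiodic at p = q, and such a sequence vanishes. The general
   case follows by summing over the grid (y + r)/a, (z + s)/b with signs (-1)^(r+s),
   using Raabe's multiplication formula sum_(r < |a|) (-1)^r Ebar_m(u + r/a) =
   sgn(a) a^(-m) Ebar_m(a u) for odd a. *)
Require Import Defs.
From mathcomp Require Import all_boot all_order all_algebra.
From mathcomp Require Import reals.
From mathcomp Require Import ring lra zify.
Import Order.TTheory GRing.Theory Num.Theory.
Local Open Scope ring_scope.
Set Implicit Arguments. Unset Strict Implicit. Unset Printing Implicit Defensive.

(** The vanishing of an antiperiodic Appell sequence is used three times: for the reflection E_n(1 -
    x) = (-1)^n E_n(x), for the product expansion and for Raabe's formula. Each identity then
    reduces to comparing polynomial values at two points at distance 1.

    The obstacle is the behaviour at integers, where Ebar_0 and Bbar_1 take the mean of their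
    one-sided limits instead of the polynomial value. The polynomial identity must be corrected at u
    = v, u = 0 and v = 0. These corrections cancel except when m = n = 0 and both arguments are
    integers, which is the origin of the term with two deltas.

    The gcd enters through the single term Ebar_N(v - u), N = m + n + 1, which involves both grid
    variables and no Bernoulli factor. After summation over one variable its argument advances by
    a/b at each step, and only the reduced fraction a'/b' matters: the remaining sum runs gcd(a, b)
    times through the residues modulo b'. *)

Section IteratedRcons.
Variables (T : Type) (x0 : T) (next : seq T -> T).

(** Common form of [euler_seq] and [bern_seq]: each entry is computed from the list of all earlier
    ones, so the entry at index i is independent of the length of the iteration. *)
Definition course (n : nat) : seq T := iter n (fun s => rcons s (next s)) [::].

Lemma size_course n : size (course n) = n.
Proof. by elim: n => //= n IHn; rewrite size_rcons IHn. Qed.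

Lemma course_mkseq n : course n = mkseq (fun i => nth x0 (course i.+1) i) n.
Proof.
elim: n => // n IHn; rewrite mkseqS -IHn /=; congr rcons.
by rewrite nth_rcons size_course ltnn eqxx.
Qed.

Lemma nth_course n : nth x0 (course n.+1) n = next (course n).
Proof. by rewrite /= nth_rcons size_course ltnn eqxx. Qed.

Lemma nth_course_lt n i : (i < n)%N -> nth x0 (course n) i = nth x0 (course i.+1) i.
Proof. by move=> lt_in; rewrite course_mkseq nth_mkseq. Qed.

End IteratedRcons.

(** * Appell sequences of polynomials *)

Section Appell.
Variable R : realType.
Implicit Types (c : nat -> R) (p : {poly R}) (x y : R).

Lemma deriv0_const p x : p^`() = 0 -> p = (p.[x])%:P.
Proof.
move=> dp0; have [c ->] : exists a, p = a%:P; last by rewrite hornerC.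
exists p`_0; apply/polyP => -[|i]; rewrite coefC //=.
move/polyP/(_ i)/eqP: dp0; rewrite coef_deriv coef0 mulrn_eq0 /=.
by move/eqP.
Qed.

(** By induction [d n] has zero derivative, hence is a constant c, and antiperiodicity at the single
    point x gives c = -c. *)
Lemma appell_antiperiodic_eq0 (d : nat -> {poly R}) x :
  (d 0%N)^`() = 0 -> (forall n, (d n.+1)^`() = n.+1%:R *: d n) ->
  (forall n, (d n).[x + 1] = - (d n).[x]) -> forall n, d n = 0.
Proof.
move=> d0 dS dx.
have const_eq0 n : (d n)^`() = 0 -> d n = 0.
  move=> /deriv0_const dE; have := dx n; rewrite (dE x) !hornerC => e.
  by have -> : (d n).[x] = 0 by lra.
elim=> [|n IHn]; first exact: const_eq0.
by apply: const_eq0; rewrite dS IHn scaler0.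
Qed.

Definition appell c (n : nat) : {poly R} :=
  \sum_(k < n.+1) ('C(n, k)%:R * c k) *: 'X^(n - k).

Lemma appell0 c : appell c 0 = (c 0%N)%:P.
Proof. by rewrite /appell big_ord1 bin0 mul1r expr0 alg_polyC. Qed.

Lemma horner_appell c n x :
  (appell c n).[x] = \sum_(k < n.+1) 'C(n, k)%:R * c k * x ^+ (n - k).
Proof.
by rewrite horner_sum; apply: eq_bigr => k _; rewrite hornerZ hornerXn.
Qed.

Lemma horner_appell0 c n : (appell c n).[0] = c n.
Proof.
rewrite horner_appell big_ord_recr /= subnn expr0 binn mul1r mulr1 big1 ?add0r //.
by move=> k _; rewrite expr0n subn_eq0 leqNgt ltn_ord mulr0.
Qed.

Lemma deriv_appell c n : (appell c n.+1)^`() = n.+1%:R *: appell c n.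
Proof.
rewrite /appell big_ord_recr /= subnn expr0 derivD alg_polyC derivC addr0.
rewrite raddf_sum scaler_sumr; apply: eq_bigr => k _ /=.
rewrite derivZ derivXn subSn ?(ltnSE (ltn_ord k)) //= scalerA -scaler_nat scalerA.
congr (_ *: _); rewrite mulrAC mulrA -!natrM; congr (_%:R * _).
by rewrite mulnC -subSn ?(ltnSE (ltn_ord k)) // -mul_bin_down.
Qed.

(** Both sides satisfy the Appell relation and agree at 0, so by induction their difference has zero
    derivative and vanishes at 0. *)
Lemma appell_shift c n x :
  appell c n \Po ('X + x%:P) = appell (fun k => (appell c k).[x]) n.
Proof.
apply/eqP; rewrite -subr_eq0; apply/eqP.
have d0 k : (appell c k \Po ('X + x%:P)
   - appell (fun k => (appell c k).[x]) k).[0] = 0.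
  by rewrite hornerD hornerN horner_comp !hornerE horner_appell0 ?add0r subrr.
elim: n => [|n IHn].
  rewrite (@deriv0_const (_ - _) 0) ?d0 //.
  by rewrite !appell0 comp_polyC derivB !derivC subr0.
rewrite (@deriv0_const (_ - _) 0) ?d0 //.
rewrite derivB deriv_comp !deriv_appell derivD derivX derivC addr0 mulr1.
by rewrite linearZ /= -scalerBr IHn scaler0.
Qed.

Lemma appellD c n x y : (appell c n).[x + y] =
  \sum_(k < n.+1) 'C(n, k)%:R * (appell c k).[x] * y ^+ (n - k).
Proof.
have := horner_appell (fun k => (appell c k).[x]) n y.
by rewrite -appell_shift horner_comp !hornerE addrC.
Qed.

End Appell.

(** * Difference and reflection formulas for Euler and Bernoulli polynomials *)

Section EulerBernoulli.
Variable R : realType.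
Implicit Types (x y : R).

Definition Epoly n := appell (@euler_num R) n.
Definition Bpoly n := appell (@bern_num R) n.

Lemma eulerPE n x : eulerP n x = (Epoly n).[x].
Proof. by rewrite horner_appell. Qed.

Lemma bernPE n x : bernP n x = (Bpoly n).[x].
Proof. by rewrite horner_appell. Qed.

Lemma Epoly0 : Epoly 0 = (euler_num R 0)%:P.
Proof. exact: appell0. Qed.

Lemma deriv_Epoly n : (Epoly n.+1)^`() = n.+1%:R *: Epoly n.
Proof. exact: deriv_appell. Qed.

Lemma deriv_Bpoly n : (Bpoly n.+1)^`() = n.+1%:R *: Bpoly n.
Proof. exact: deriv_appell. Qed.

Lemma EpolyD n x y : (Epoly n).[x + y] =
  \sum_(k < n.+1) 'C(n, k)%:R * (Epoly k).[x] * y ^+ (n - k).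
Proof. exact: appellD. Qed.

Lemma euler_num_rec n :
  \sum_(j < n.+1) 'C(n, j)%:R * euler_num R j + euler_num R n = 2 * (n == 0%N)%:R.
Proof.
rewrite big_ord_recr /= binn mul1r.
rewrite {2 3}/euler_num [euler_seq R n](_ : _ = course (@euler_next R) n.+1) //.
rewrite nth_course /euler_next size_course.
rewrite (eq_bigr (fun j : 'I_n => 'C(n, j)%:R * (course (@euler_next R) n)`_j)).
  by field.
by move=> j _; rewrite nth_course_lt.
Qed.

Lemma bern_num_rec n :
  \sum_(j < n.+1) 'C(n.+1, j)%:R * bern_num R j = (n == 0%N)%:R.
Proof.
rewrite big_ord_recr /=.
rewrite {2}/bern_num [bern_seq R n](_ : _ = course (@bern_next R) n.+1) //.
rewrite nth_course /bern_next size_course binSn.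
rewrite (eq_bigr (fun j : 'I_n => 'C(n.+1, j)%:R * (course (@bern_next R) n)`_j)).
  by field; rewrite addrC natr1 pnatr_eq0.
by move=> j _; rewrite nth_course_lt.
Qed.

Lemma Epoly1 n : (Epoly n).[1] + (Epoly n).[0] = 2 * (n == 0%N)%:R.
Proof.
rewrite horner_appell0 -euler_num_rec horner_appell; congr (_ + _).
by apply: eq_bigr => k _; rewrite expr1n mulr1.
Qed.

(** Expanding around 1 and around 0 leaves the coefficients E_k(1) + E_k(0), which vanish except for
    k = 0. *)
Lemma EpolyS n x : (Epoly n).[x + 1] = 2 * x ^+ n - (Epoly n).[x].
Proof.
apply/eqP; rewrite eq_sym subr_eq eq_sym; apply/eqP.
rewrite addrC [x + 1]addrC -{1}[x]add0r !appellD -big_split /=.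
rewrite big_ord_recl big1 /=.
  by rewrite bin0 addr0 !mul1r -mulrDl addrC Epoly1 mulr1 subn0.
move=> i _; rewrite -mulrDl -mulrDr addrC [_ + _](Epoly1 (bump 0 i)).
by rewrite mulr0 mulr0 mul0r.
Qed.

(** The sign (-1)^n absorbs the -1 from differentiating 1 - X, so the defect is Appell;
    antiperiodicity at 0 involves only E_k(0) and E_k(1). *)
Lemma Epoly_reflect n x : (Epoly n).[1 - x] = (-1) ^+ n * (Epoly n).[x].
Proof.
pose d n := ((-1) ^+ n *: (Epoly n \Po (1 - 'X)) - Epoly n).
suff d0 k : d k = 0.
  have := congr1 (fun p : {poly R} => p.[x]) (d0 n).
  rewrite /d !hornerE horner_comp !hornerE => /eqP; rewrite subr_eq0 => /eqP <-.
  by rewrite signrMK.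
move: k; apply: (@appell_antiperiodic_eq0 _ d 0).
- by rewrite /d /Epoly !appell0 comp_polyC linearB linearZ /= !derivC scaler0 subr0.
- move=> k; rewrite /d derivB derivZ deriv_comp !deriv_appell.
  rewrite derivB derivX -polyC1 derivC sub0r mulrN1 linearZ /= scalerBr exprS.
  by rewrite -/(Epoly k) mulN1r scaleNr scalerN opprK !scalerA mulrC.
move=> k; rewrite /d !hornerE !horner_comp !hornerE.
have := EpolyS k 0; have -> : (0:R) ^+ k = (k == 0%N)%:R by rewrite expr0n.
rewrite add0r subrr subr0 => ->.
by case: k => [|k] /=; rewrite ?expr0; ring.
Qed.

(** Here the differences B_k(1) - B_k(0) survive only for k = 1, and the binomial C(n, 1) supplies
    the factor n. *)
Lemma BpolyS n x : (Bpoly n).[x + 1] = (Bpoly n).[x] + n%:R * x ^+ n.-1.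
Proof.
have B1 k : (Bpoly k).[1] = (Bpoly k).[0] + (k == 1%N)%:R.
  rewrite horner_appell0 horner_appell big_ord_recr /= binn mul1r subnn expr0.
  rewrite mulr1 addrC; congr (_ + _); case: k => [|k]; first by rewrite big_ord0.
  rewrite -(bern_num_rec k).
  by apply: eq_bigr => j _; rewrite expr1n mulr1.
rewrite [x + 1]addrC -{2}[x]add0r !appellD.
under eq_bigr => k _ do rewrite -/(Bpoly k) B1 mulrDr mulrDl.
rewrite big_split /=; congr (_ + _); case: n => [|n].
  by rewrite big_ord1 /= mulr0 !mul0r.
rewrite big_ord_recl big_ord_recl /= big1 ?addr0.
  by rewrite mulr0 mul0r add0r mulr1 bin1 subn1.
by move=> i _; rewrite mulr0 mul0r.
Qed.

Lemma Bpoly0 : Bpoly 0 = 1.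
Proof.
by rewrite /Bpoly appell0; have := bern_num_rec 0; rewrite big_ord1 bin0 mul1r => ->.
Qed.

End EulerBernoulli.

(** * Expansion of a product of two Euler polynomials *)

Section ProductFormula.
Variable R : realType.
Implicit Types (p q x y : R).

Local Notation Ep := (@Epoly R).
Local Notation Bp := (@Bpoly R).

(** [T1], [T2] and [T3] are polynomials in p, with q and n fixed, scaled to satisfy the Appell
    relation in m. [T3 n q 0] is not constant: its derivative is (-1)^n E_n(X - q). The Beta-type
    coefficient m! n!/(m+n+1)! and the sign of [T1] are chosen so that [T1 n q 0] cancels this
    derivative. *)
Let T1 n q m : {poly R} :=
  ((-1) ^+ n.+1 * m`!%:R * n`!%:R / (m + n).+1`!%:R) *: (Ep (m + n).+1 \Po ('X - q%:P)).
Let T2 n q m : {poly R} :=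
  \sum_(j < m.+1) ('C(m, j)%:R / ((m + n).+1 - j)%:R * (Bp ((m + n).+1 - j)).[q])
    *: (Ep j \Po ('X - q%:P)).
Let T3 n q m : {poly R} :=
  \sum_(j < n.+1) ('C(n, j)%:R * (-1) ^+ j / ((m + n).+1 - j)%:R)
    *: ((Ep j \Po ('X - q%:P)) * Bp ((m + n).+1 - j)).

Lemma deriv_EpolyB n q :
  (Ep n.+1 \Po ('X - q%:P))^`() = n.+1%:R *: (Ep n \Po ('X - q%:P)).
Proof.
by rewrite deriv_comp deriv_Epoly derivB derivX derivC subr0 mulr1 linearZ.
Qed.

Lemma deriv_EpolyB0 q : (Ep 0 \Po ('X - q%:P))^`() = 0.
Proof. by rewrite Epoly0 comp_polyC derivC. Qed.

Let deriv_T1 n q m : (T1 n q m.+1)^`() = m.+1%:R *: T1 n q m.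
Proof.
rewrite /T1 derivZ addSn deriv_EpolyB !scalerA; congr (_ *: _).
rewrite !factS !natrM; field.
rewrite -!natrD nat1r !pnatr_eq0 -lt0n fact_gt0.
by [].
Qed.

Let deriv_T2 n q m : (T2 n q m.+1)^`() = m.+1%:R *: T2 n q m.
Proof.
rewrite /T2 big_ord_recl /= derivD derivZ deriv_EpolyB0 scaler0 add0r.
rewrite raddf_sum scaler_sumr; apply: eq_bigr => j _ /=.
rewrite /bump /= add1n derivZ deriv_EpolyB !scalerA addSn subSS; congr (_ *: _).
rewrite mulrAC [in RHS]mulrA; congr (_ * _); rewrite mulrAC mulrA; congr (_ / _).
by rewrite -!natrM mulnC -mul_bin_diag.
Qed.

Let deriv_T3_split n q m : (T3 n q m)^`() =
  \sum_(j < n.+1) ('C(n, j)%:R * (-1) ^+ j / ((m + n).+1 - j)%:R)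
    *: ((Ep j \Po ('X - q%:P))^`() * Bp ((m + n).+1 - j))
  + \sum_(j < n.+1) ('C(n, j)%:R * (-1) ^+ j)
    *: ((Ep j \Po ('X - q%:P)) * Bp ((m + n) - j)).
Proof.
rewrite /T3 raddf_sum -big_split; apply: eq_bigr => j _ /=.
rewrite derivZ derivM scalerDr; congr (_ + _).
rewrite subSn; last by apply: leq_trans (leq_addl m n); rewrite -ltnS.
by rewrite deriv_Bpoly -scalerAr scalerA divfK // pnatr_eq0.
Qed.

(** After an index shift both halves of the product rule carry E_j B_{m+n-j}. Since C(n, j+1) (j+1)
    = C(n, j) (n-j), they combine through 1 - (n-j)/(m+n-j) = m/(m+n-j). This factor m yields the
    Appell relation, and at m = 0 it removes all terms but the last. *)
Let deriv_T3_merge n q m : (T3 n q m)^`() =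
  \sum_(j < n) ('C(n, j)%:R * (-1) ^+ j * m%:R / (m + n - j)%:R)
    *: ((Ep j \Po ('X - q%:P)) * Bp (m + n - j))
  + (-1) ^+ n *: ((Ep n \Po ('X - q%:P)) * Bp m).
Proof.
rewrite deriv_T3_split big_ord_recl /= deriv_EpolyB0 mul0r scaler0 add0r.
rewrite [X in _ + X]big_ord_recr /= binn mul1r addnK addrA; congr (_ + _).
rewrite -big_split; apply: eq_bigr => j _ /=.
rewrite /bump /= add1n deriv_EpolyB subSS -scalerAl scalerA -scalerDl.
congr (_ *: _); have ltjn := ltn_ord j.
have E : 'C(n, j.+1)%:R * j.+1%:R = 'C(n, j)%:R * (n - j)%:R :> R.
  by rewrite -!natrM mulnC mul_bin_left mulnC.
have nz : (m + n - j)%:R != 0 :> R.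
  by rewrite pnatr_eq0 subn_eq0 -ltnNge (leq_trans ltjn) ?leq_addl.
transitivity (((-1) ^+ j) * ('C(n, j)%:R - ('C(n, j.+1)%:R * j.+1%:R) / (m + n - j)%:R) :> R).
  by rewrite exprS; field.
rewrite E.
have -> : m%:R = (m + n - j)%:R - (n - j)%:R :> R.
  by rewrite -natrB ?leq_sub2r ?leq_addl //; congr (_%:R); lia.
by field.
Qed.

Let deriv_T30 n q : (T3 n q 0)^`() = (-1) ^+ n *: (Ep n \Po ('X - q%:P)).
Proof.
rewrite deriv_T3_merge big1 ?add0r => [|j _]; last by rewrite mulr0 mul0r scale0r.
by rewrite Bpoly0 mulr1.
Qed.

Let deriv_T3S n q m : (T3 n q m.+1)^`() = m.+1%:R *: T3 n q m.
Proof.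
rewrite deriv_T3_merge /T3 scaler_sumr [in RHS]big_ord_recr /=; congr (_ + _).
  by apply: eq_bigr => j _; rewrite scalerA addSn; congr (_ *: _); ring.
rewrite scalerA binn mul1r subSn ?leq_addl // addnK; congr (_ *: _).
by field; rewrite addrC natr1 pnatr_eq0.
Qed.

Let T1S n q m : (T1 n q m).[q + 1] = - (T1 n q m).[q].
Proof.
rewrite /T1 !hornerZ !horner_comp !hornerE -mulrN; congr (_ * _).
have -> : q + 1 - q = 1 by ring.
by rewrite subrr; apply/eqP; rewrite -addr_eq0 Epoly1 mulr0.
Qed.

Let EBS j q : (Ep j \Po ('X - q%:P)).[q + 1]
   = 2 * (j == 0%N)%:R - (Ep j).[0].
Proof.
rewrite horner_comp !hornerE; have -> : q + 1 - q = 1 by ring.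
by rewrite -Epoly1 addrK.
Qed.

Let EB0 j q : (Ep j \Po ('X - q%:P)).[q] = (Ep j).[0].
Proof. by rewrite horner_comp !hornerE subrr. Qed.

Let T2S n q m : (T2 n q m).[q + 1] =
  2 * (Bp (m + n).+1).[q] / (m + n).+1%:R - (T2 n q m).[q].
Proof.
rewrite /T2; move: Bp => B; rewrite !horner_sum -sumrN !big_ord_recl /= bin0 subn0 mul1r.
rewrite !hornerZ !EBS !EB0 /= addrA; congr (_ + _); first by ring.
apply: eq_bigr => j _; rewrite !hornerZ EBS EB0 /=; ring.
Qed.

(** Replacing E_j(1) by 2[j = 0] - E_j(0) gives the Bernoulli term. Passing from B(q + 1) to B(q) in
    the rest leaves powers q^(m+n-j), which add up to q^m E_n(1 + q) by the reflection formula. *)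
Let T3S n q m : (T3 n q m).[q + 1] = 2 * (Bp (m + n).+1).[q + 1] / (m + n).+1%:R
   - q ^+ m * (Ep n).[1 + q] - (T3 n q m).[q].
Proof.
have -> : (Ep n).[1 + q] = 
  \sum_(j < n.+1) 'C(n, j)%:R * (-1) ^+ j * (Ep j).[0] * q ^+ (n - j).
  have := Epoly_reflect n (- q); rewrite opprK => ->.
  rewrite -[- q]add0r EpolyD mulr_sumr; apply: eq_bigr => j _.
  rewrite (exprNn q).
  have -> : (-1 : R) ^+ n = (-1) ^+ j * (-1) ^+ (n - j).
    by rewrite -exprD subnKC // -ltnS.
  transitivity (((-1) ^+ (n - j)) ^+ 2
    * ('C(n, j)%:R * (-1) ^+ j * (Ep j).[0] * q ^+ (n - j)) :> R).
    by ring.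
  by rewrite sqrr_sign mul1r.
have -> : 2 * (Bp (m + n).+1).[q + 1] / (m + n).+1%:R = 
  \sum_(j < n.+1) 2 * (j == 0 :> nat)%:R * ('C(n, j)%:R * (-1) ^+ j / ((m + n).+1 - j)%:R)
    * (Bp ((m + n).+1 - j)).[q + 1].
  rewrite big_ord_recl big1 => [|j _]; last by rewrite /= mulr0 !mul0r.
  by rewrite /= bin0 expr0 subn0; ring.
rewrite /T3 !horner_sum mulr_sumr -!sumrB; apply: eq_bigr => j _.
rewrite !hornerZ !hornerM EBS EB0.
have lejn : (j <= n)%N by rewrite -ltnS.
rewrite BpolyS subSn; last by apply: leq_trans lejn (leq_addl _ _).
rewrite /= -addnBA // exprD; field.
by rewrite -natrD nat1r pnatr_eq0.
Qed.

Lemma Epoly_prod m n p q :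
  let N := (m + n).+1 in
  (Ep m).[p] * (Ep n).[q] =
    2 * ((-1) ^+ n.+1 * m`!%:R * n`!%:R / N`!%:R * (Ep N).[p - q])
  - 2 * (\sum_(j < m.+1) 'C(m, j)%:R / (N - j)%:R * (Bp (N - j)).[q] * (Ep j).[p - q])
  + 2 * (\sum_(j < n.+1) 'C(n, j)%:R * (-1) ^+ j / (N - j)%:R
           * ((Ep j).[p - q] * (Bp (N - j)).[p])).
Proof.
move=> N; pose d k := (Ep n).[q] *: Ep k - 2 *: T1 n q k + 2 *: T2 n q k - 2 *: T3 n q k.
have hd k x : (d k).[x] = (Ep n).[q] * (Ep k).[x] - 2 * (T1 n q k).[x]
    + 2 * (T2 n q k).[x] - 2 * (T3 n q k).[x].
  by rewrite /d; move: (T1 n q k) (T2 n q k) (T3 n q k) => t1 t2 t3; rewrite !hornerE.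
have d0 k : d k = 0.
  move: k; apply: (@appell_antiperiodic_eq0 _ d q) => [|k|k].
  - rewrite /d !(derivB, derivD) !derivZ deriv_T30 Epoly0 derivC.
    rewrite /T1 /T2 big_ord1 /= !derivZ deriv_EpolyB0 deriv_EpolyB !scaler0.
    rewrite sub0r addr0 !scalerA -opprD -scalerDl factS natrM.
    set c := (X in - (X *: _)); suff -> : c = 0 by rewrite scale0r oppr0.
    rewrite /c exprS fact0 mulr1 add0n; field.
    by rewrite pnatr_eq0 -lt0n fact_gt0 nat1r pnatr_eq0.
  - rewrite /d !(derivB, derivD) (derivZ _ (Ep k.+1)) (derivZ 2 (T1 n q k.+1)).
    rewrite (derivZ 2 (T2 n q k.+1)) (derivZ 2 (T3 n q k.+1)).
    rewrite deriv_T3S deriv_T1 deriv_T2 deriv_Epoly.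
    by rewrite !(scalerBr, scalerDr) !scalerA ![_ * k.+1%:R]mulrC.
  (* The two values add up to 2 q^m (E_n(q) + E_n(q+1)) - 4 (B_N(q+1) - B_N(q))/N with N = k + n + 1
     and m = k; both parts equal 4 q^(k+n). *)
  rewrite !hd T1S T2S T3S EpolyS BpolyS [1 + q]addrC EpolyS /= exprD.
  by field; rewrite -natrD nat1r pnatr_eq0.
have := hd m p; rewrite d0 horner0 mulrC => /eqP.
rewrite eq_sym !(addr_eq0, subr_eq0); move/eqP; rewrite /N.
have -> : (T1 n q m).[p] = (-1) ^+ n.+1 * m`!%:R * n`!%:R / N`!%:R * (Ep N).[p - q].
  by rewrite hornerZ horner_comp hornerXsubC.
have -> : (T2 n q m).[p] = \sum_(j < m.+1)
    'C(m, j)%:R / (N - j)%:R * (Bp (N - j)).[q] * (Ep j).[p - q].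
  by rewrite horner_sum; apply: eq_bigr => j _; rewrite hornerZ horner_comp hornerXsubC.
have -> : (T3 n q m).[p] = \sum_(j < n.+1) 'C(n, j)%:R * (-1) ^+ j / (N - j)%:R
    * ((Ep j).[p - q] * (Bp (N - j)).[p]).
  rewrite horner_sum; apply: eq_bigr => j _.
  by rewrite hornerZ hornerM horner_comp hornerXsubC.
by rewrite opprK => <-; ring.
Qed.

End ProductFormula.

(** * Quasi-periodic Euler functions and Bernoulli functions *)

Section QuasiPeriodic.
Variable R : realType.
Implicit Types (x y u v w : R) (k : int).

Local Notation Ep := (@Epoly R).
Local Notation Bp := (@Bpoly R).

Lemma signzD k l : (-1 : R) ^ (k + l) = (-1) ^ k * (-1) ^ l.
Proof. by rewrite exprzDr // unitrN1. Qed.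

Lemma signzN k : (-1 : R) ^ (- k) = (-1) ^ k.
Proof. by rewrite !expN1r abszN. Qed.

Lemma floorDint x k : Num.floor (x + k%:~R) = Num.floor x + k.
Proof. by rewrite floorDrz ?intr_int // intrKfloor. Qed.

Lemma fracpDint x k : fracp (x + k%:~R) = fracp x.
Proof. by rewrite /fracp floorDint intrD; ring. Qed.

Lemma fracp_bounds x : 0 <= fracp x < 1.
Proof.
by have := floor_itv x; rewrite /fracp intrD => /andP[]; lra.
Qed.

Lemma fracpE x : x = fracp x + (Num.floor x)%:~R.
Proof. by rewrite /fracp subrK. Qed.

Lemma intrDint x k : (x + k%:~R \is a Num.int) = (x \is a Num.int).
Proof. by rewrite rpredDr // intr_int. Qed.

Lemma unit_floor w : 0 <= w < 1 -> Num.floor w = 0.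
Proof. by move=> w01; apply/eqP; rewrite floor_eq. Qed.

Lemma unit_int w : 0 <= w < 1 -> (w \is a Num.int) = (w == 0).
Proof. by move=> w01; rewrite intrEfloor unit_floor // eq_sym. Qed.

Lemma EbarD n x k : Ebar n (x + k%:~R) = (-1) ^ k * Ebar n x.
Proof.
rewrite /Ebar fracpDint floorDint intrDint signzD mulrC.
by case: n => [|n]; last ring; case: ifP => _; rewrite ?mulr0 // mulrC.
Qed.

Lemma BbarD n x k : Bbar n (x + k%:~R) = Bbar n x.
Proof. by rewrite /Bbar fracpDint intrDint. Qed.

(* The term (-1)^(ax+bx-y-z) delta_Z(ax-y) delta_Z(bx-z) is signZ (ax-y) * signZ (bx-z). *)
Definition signZ x : R := (-1) ^ (Num.floor x) * deltaZ x.

Lemma signZD x k : signZ (x + k%:~R) = (-1) ^ k * signZ x.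
Proof. by rewrite /signZ /deltaZ floorDint intrDint signzD; ring. Qed.

Lemma signZN x : signZ (- x) = signZ x.
Proof.
rewrite /signZ /deltaZ rpredN; case: ifP; rewrite ?mulr0 // intrEfloor => /eqP e.
by rewrite -e -mulrNz !intrKfloor signzN.
Qed.

Lemma unit_signZ w : 0 <= w < 1 -> signZ w = (w == 0)%:R.
Proof.
by move=> w01; rewrite /signZ /deltaZ unit_floor // unit_int // mul1r; case: eqP.
Qed.

Lemma unit_Ebar n w : 0 <= w < 1 ->
  Ebar n w = (Ep n).[w] - ((n == 0%N) && (w == 0))%:R.
Proof.
move=> w01; rewrite /Ebar unit_int // /fracp unit_floor // subr0 !eulerPE expr0z.
case: n => [|n] /=; rewrite ?subr0 ?mul1r //.
have -> : (Ep 0).[w] = 1.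
  by have := EpolyS 0 w; rewrite Epoly0 !hornerC expr0 => e; lra.
by case: eqP; rewrite ?subrr ?subr0.
Qed.

Lemma unit_Bbar n w : 0 <= w < 1 ->
  Bbar n.+1 w = (Bp n.+1).[w] + ((n == 0%N) && (w == 0))%:R / 2.
Proof.
move=> w01; rewrite /Bbar unit_int // /fracp unit_floor // subr0 !bernPE.
case: n => [|n] /=; last by rewrite mul0r addr0.
have -> : (Bp 1).[w] = w - 2^-1.
  have b0 : bern_num R 0 = 1.
    by have := bern_num_rec R 0; rewrite big_ord1 bin0 mul1r.
  have := bern_num_rec R 1.
  rewrite horner_appell !(big_ord_recr, big_ord0) /= b0 !bin1 !bin0 subn0 expr1 subnn expr0.
  by move=> e; lra.
by case: eqP => [->|_] /=; field.
Qed.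

(** For 0 < w < 1, write -w = (1 - w) - 1 and reflect. At w = 0 the point 1 - w leaves [0, 1), and
    the claim becomes Ebar_n(0) = 0 for even n. *)
Lemma EbarN n x : Ebar n (- x) = (-1) ^+ n.+1 * Ebar n x.
Proof.
have wE w : 0 <= w < 1 -> Ebar n (- w) = (-1) ^+ n.+1 * Ebar n w.
  move=> w01; have [->|w0] := eqVneq w 0.
    rewrite oppr0 unit_Ebar ?lexx ?ltr01 // eqxx andbT.
    have := Epoly_reflect n (0 : R); rewrite subr0 => e1.
    have := Epoly1 R n; rewrite e1 exprS.
    case: n {e1} => [|n] /=; rewrite ?expr0 => e; last by lra.
    by lra.
  have /andP[w_ge0 w_lt1] := w01.
  have w_gt0 : 0 < w by rewrite lt_neqAle eq_sym w0.
  have -> : - w = 1 - w + (-1)%:~R by ring.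
  rewrite EbarD !unit_Ebar //; last first.
    by apply/andP; split; lra.
  rewrite Epoly_reflect (negPf w0) subr_eq0 (gt_eqF w_lt1).
  by rewrite !andbF !subr0 exprN1 invrN1 exprS mulrA.
rewrite [in LHS](fracpE x) opprD -mulrNz EbarD signzN wE ?fracp_bounds //.
by rewrite mulrCA -EbarD -fracpE.
Qed.

End QuasiPeriodic.

Arguments Ebar : simpl never.
Arguments Bbar : simpl never.

(** * The product formula with its corrections at integers *)

Section BarProduct.
Variable R : realType.
Implicit Types (x y u v w : R) (k : int).

Local Notation Ep := (@Epoly R).
Local Notation Bp := (@Bpoly R).

(* On [0, 1), Ebar_0 and Bbar_1 differ from E_0 and B_1 only at integers: e and b are
   these two defects. *)
Lemma sum_unit_corrections m N (c E B : nat -> R) (e b : R) : (m < N)%N ->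
  \sum_(j < m.+1) c j *
    ((E j - (j == 0 :> nat)%:R * e) * (B (N - j)%N + ((N - j)%N == 1%N)%:R * b))
  = \sum_(j < m.+1) c j * (E j * B (N - j)%N) - c 0%N * e * B N
    + (N == m.+1)%:R * c m * (E m - (m == 0%N)%:R * e) * b.
Proof.
move=> ltmN.
have -> : c 0%N * e * B N = \sum_(j < m.+1) (j == 0 :> nat)%:R * (c j * e * B (N - j)%N).
  rewrite big_ord_recl big1 => [|j _]; first by rewrite /= subn0 mul1r addr0.
  by rewrite mul0r.
have -> : (N == m.+1)%:R * c m * (E m - (m == 0%N)%:R * e) * b
  = \sum_(j < m.+1) ((N - j)%N == 1%N)%:R * (c j * (E j - (j == 0 :> nat)%:R * e) * b).
  rewrite big_ord_recr big1 /= => [|j _].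
    have -> : (N - m == 1)%N = (N == m.+1) by lia.
    by rewrite add0r !mulrA.
  have -> : (N - j == 1)%N = false by have := ltn_ord j; lia.
  by rewrite mul0r.
by rewrite -sumrB -big_split; apply: eq_bigr => j _ /=; ring.
Qed.

(* The case a = b = 1, written with u = y - x and v = z - x. *)
Definition bar_product_formula m n u v : Prop :=
  let N := (m + n).+1 in
  Ebar m u * Ebar n v + ((m == 0%N) && (n == 0%N))%:R * signZ u * signZ v
  + (-1) ^+ m * 2 * m`!%:R * n`!%:R / N`!%:R * Ebar N (v - u)
  = 2 * (\sum_(j < m.+1) 'C(m, j)%:R * (-1) ^+ j / (N - j)%:R
           * (Ebar j (v - u) * Bbar (N - j) v))
  + 2 * (\sum_(j < n.+1) 'C(n, j)%:R * (-1) ^+ j / (N - j)%:R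
           * (Ebar j (u - v) * Bbar (N - j) u)).

(** Parity at index m + n + 1 contributes (-1)^(m+n), which exchanges (-1)^m and (-1)^n. This
    permits assuming u <= v. *)
Lemma bar_product_sym m n u v :
  bar_product_formula m n u v -> bar_product_formula n m v u.
Proof.
rewrite /bar_product_formula /= [(n + m)%N]addnC [_ && (m == _)]andbC => e.
rewrite [RHS]addrC -e -(opprB v u) EbarN !exprS exprD.
congr (_ + _); first by ring.
transitivity (((-1) ^+ n) ^+ 2 * ((-1) ^+ m * 2 * m`!%:R * n`!%:R / (m + n).+1`!%:R
  * Ebar (m + n).+1 (v - u)) : R); last by rewrite sqrr_sign mul1r.
by ring.
Qed.

(** Since v - u lies in [0, 1), each Ebar_j(v - u) is a polynomial value up to its defect at 0, and
    Ebar_j(u - v) follows by parity. [Epoly_prod] is used with p = v, q = u and with m and n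
    exchanged; the rest is an account of the defects. *)
Lemma unit_bar_product_le m n u v : 0 <= u -> u <= v -> v < 1 ->
  bar_product_formula m n u v.
Proof.
move=> u_ge0 le_uv v_lt1.
have u01 : 0 <= u < 1 by apply/andP; split; lra.
have v01 : 0 <= v < 1 by apply/andP; split; lra.
have h01 : 0 <= v - u < 1 by apply/andP; split; lra.
rewrite /bar_product_formula; set N := (m + n).+1 => /=.
rewrite !unit_signZ // !unit_Ebar //= subr0.
have Bw w (k : nat) : 0 <= w < 1 -> (0 < k)%N ->
    Bbar k w = (Bp k).[w] + (k == 1%N)%:R * ((w == 0)%:R / 2).
  by case: k => // k w01 _; rewrite unit_Bbar // eqSS -mulnb natrM mulrA.
have Eh j : Ebar j (v - u) = (Ep j).[v - u] - (j == 0%N)%:R * (u == v)%:R.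
  by rewrite unit_Ebar // -mulnb natrM subr_eq0 [v == u]eq_sym.
have -> : \sum_(j < m.+1) 'C(m, j)%:R * (-1) ^+ j / (N - j)%:R
    * (Ebar j (v - u) * Bbar (N - j) v) = \sum_(j < m.+1) 'C(m, j)%:R * (-1) ^+ j / (N - j)%:R
    * (((Ep j).[v - u] - (j == 0 :> nat)%:R * (u == v)%:R) *
    ((Bp (N - j)).[v] + ((N - j)%N == 1%N)%:R * ((v == 0)%:R / 2))).
  apply: eq_bigr => j _; rewrite Eh Bw // subn_gt0 /N.
  by have := ltn_ord j; lia.
have -> : \sum_(j < n.+1) 'C(n, j)%:R * (-1) ^+ j / (N - j)%:R
    * (Ebar j (u - v) * Bbar (N - j) u) = - \sum_(j < n.+1) 'C(n, j)%:R / (N - j)%:R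
    * (((Ep j).[v - u] - (j == 0 :> nat)%:R * (u == v)%:R) *
    ((Bp (N - j)).[u] + ((N - j)%N == 1%N)%:R * ((u == 0)%:R / 2))).
  rewrite -sumrN; apply: eq_bigr => j _; rewrite -(opprB v u) EbarN Eh Bw //.
    rewrite exprS.
    transitivity (- (((-1) ^+ j) ^+ 2 * ('C(n, j)%:R / (N - j)%:R
      * (((Ep j).[v - u] - (j == 0 :> nat)%:R * (u == v)%:R) *
      ((Bp (N - j)).[u] + ((N - j)%N == 1%N)%:R * ((u == 0)%:R / 2))))) : R).
      by ring.
    by rewrite sqrr_sign mul1r.
  by rewrite subn_gt0 /N; have := ltn_ord j; lia.
rewrite (@sum_unit_corrections m N (fun j => 'C(m, j)%:R * (-1) ^+ j / (N - j)%:R)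
  (fun j => (Ep j).[v - u]) (fun j => (Bp j).[v])); last by rewrite /N; lia.
rewrite (@sum_unit_corrections n N (fun j => 'C(n, j)%:R / (N - j)%:R)
  (fun j => (Ep j).[v - u]) (fun j => (Bp j).[u])); last by rewrite /N; lia.
have := Epoly_prod n m v u; rewrite [(n + m)%N]addnC -/N /=.
have -> : \sum_(j < n.+1) 'C(n, j)%:R / (N - j)%:R * (Bp (N - j)).[u] * (Ep j).[v - u]
  = \sum_(j < n.+1) 'C(n, j)%:R / (N - j)%:R * ((Ep j).[v - u] * (Bp (N - j)).[u]).
  by apply: eq_bigr => j _; ring.
set S1 := \sum_(j < m.+1) _; set S2 := \sum_(j < n.+1) _; move=> e.
have {e}e : 2 * S1 - 2 * S2 = (Ep m).[u] * (Ep n).[v]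
  + (-1) ^+ m * 2 * m`!%:R * n`!%:R / N`!%:R * (Ep N).[v - u].
  by rewrite [(Ep m).[u] * _]mulrC e exprS; ring.
have N_neq0 : N%:R != 0 :> R by rewrite pnatr_eq0.
(* The defect of Bbar_1 can only enter at the last index j = m, where N - j = 1 forces n = 0;
   symmetrically for [NnE]. *)
have NmE (t : R) : (N == m.+1)%:R * (t / (N - m)%:R) = (n == 0%N)%:R * t.
  rewrite /N eqSS -{2}[m]addn0 eqn_add2l; case: eqP => [->|_]; last by rewrite !mul0r.
  by rewrite addn0 subSnn divr1.
have NnE (t : R) : (N == n.+1)%:R * (t / (N - n)%:R) = (m == 0%N)%:R * t.
  rewrite /N eqSS -{2}[n]add0n eqn_add2r; case: eqP => [->|_]; last by rewrite !mul0r.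
  by rewrite add0n subSnn divr1.
(* The defects of Ebar_0 in the two sums occur only at u = v, where they cancel against each
   other. *)
have eB : (u == v)%:R * (Bp N).[v] = (u == v)%:R * (Bp N).[u].
  by case: eqP => [->|_] //; rewrite !mul0r.
rewrite NmE NnE -[_ * (u == v)%:R * (Bp N).[v]]mulrA eB !bin0 !binn expr0 subn0.
move: e; set P := _ / N`!%:R * (Ep N).[v - u] => e.
have {e} -> : S1 = S2 + ((Ep m).[u] * (Ep n).[v] + P) / 2 by lra.
rewrite -!mulnb !natrM.
have [u0|u_neq0] := eqVneq u 0; last first.
  have v_gt0 : 0 < v by rewrite (lt_le_trans _ le_uv) // lt_neqAle eq_sym u_neq0.
  by rewrite (gt_eqF v_gt0) /=; field.
rewrite u0 subr0 [0 == v]eq_sym; have [v0|v_neq0] := eqVneq v 0; last first.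
  by rewrite /=; field.
(* By parity Ebar_m(0) vanishes for even m, so in front of it (-1)^m may be replaced by -1. *)
have := EbarN m (0 : R).
rewrite v0 oppr0 unit_Ebar ?lexx ?ltr01 // eqxx andbT exprS /= !mulr1.
set X := _ - _ => eX.
have -> : (n == 0%N)%:R * (1 * (-1) ^+ m) * X = - (n == 0%N)%:R * X :> R.
  by rewrite {2}eX; ring.
by rewrite /X; field.
Qed.

Lemma bar_product m n u v : bar_product_formula m n u v.
Proof.
have unitP p q : 0 <= p < 1 -> 0 <= q < 1 -> bar_product_formula m n p q.
  move=> /andP[p0 p1] /andP[q0 q1]; case: (leP p q) => [le_pq|/ltW le_qp].
    exact: unit_bar_product_le.
  by apply: bar_product_sym; apply: unit_bar_product_le.
have := unitP _ _ (fracp_bounds u) (fracp_bounds v).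
have := fracpE u; have := fracpE v.
move: (fracp u) (fracp v) (Num.floor u) (Num.floor v) => p q k l -> ->.
rewrite /bar_product_formula; set N := (m + n).+1 => /= e.
have dE : q + l%:~R - (p + k%:~R) = q - p + (l - k)%:~R by rewrite intrB; ring.
have dE' : p + k%:~R - (q + l%:~R) = p - q + (k - l)%:~R by rewrite intrB; ring.
set K : R := (-1) ^ k; set L : R := (-1) ^ l.
have EdE j : Ebar j (q + l%:~R - (p + k%:~R)) = K * L * Ebar j (q - p).
  by rewrite dE EbarD signzD signzN -/K -/L [L * K]mulrC.
have EdE' j : Ebar j (p + k%:~R - (q + l%:~R)) = K * L * Ebar j (p - q).
  by rewrite dE' EbarD signzD signzN.
transitivity (K * L * (2 * (\sum_(j < m.+1) 'C(m, j)%:R * (-1) ^+ j / (N - j)%:R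
           * (Ebar j (q - p) * Bbar (N - j) q))
  + 2 * (\sum_(j < n.+1) 'C(n, j)%:R * (-1) ^+ j / (N - j)%:R
           * (Ebar j (p - q) * Bbar (N - j) p)))); last first.
  rewrite mulrDr !mulr_sumr; congr (_ + _); apply: eq_bigr => j _.
    by rewrite EdE BbarD; ring.
  by rewrite EdE' BbarD; ring.
by rewrite -e EdE !EbarD !signZD -/K -/L; ring.
Qed.

End BarProduct.

(** * Sums of periodic functions over residues *)

Section PeriodicSums.
Variables (V : zmodType) (h : int -> V) (q : nat).
Hypothesis hD : forall t : int, h (t + q%:Z) = h t.

Lemma periodicMD (t : int) (k : int) : h (t + k * q%:Z) = h t.
Proof.
have hMn s (i : nat) : h (s + i%:Z * q%:Z) = h s.
  by elim: i => [|i IHi]; rewrite ?mul0r ?addr0 // intS mulrDl mul1r addrCA addrC hD.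
case: k => i; first exact: hMn.
by rewrite NegzE mulNr -(hMn (t - _) i.+1) subrK.
Qed.

Lemma periodic_modz (t : int) : h t = h (t %% q%:Z)%Z.
Proof. by rewrite {1}(divz_eq t q%:Z) addrC periodicMD. Qed.

(** The map r -> c r + k permutes the residues modulo q. *)
Lemma sum_periodic_affine (c k : int) : (0 < q)%N -> coprimez c q%:Z ->
  \sum_(r < q) h (c * r%:Z + k) = \sum_(r < q) h r%:Z.
Proof.
move=> q_gt0 co_cq; have q_neq0 : q%:Z != 0 by rewrite eqz_nat -lt0n.
pose g (r : nat) := `|((c * r%:Z + k) %% q%:Z)%Z|%N.
have gE r : (g r)%:Z = ((c * r%:Z + k) %% q%:Z)%Z by rewrite /g gez0_abs ?modz_ge0.
have g_lt (r : 'I_q) : (g r < q)%N by rewrite -ltz_nat gE ltz_pmod.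
have g_inj : injective (fun r : 'I_q => Ordinal (g_lt r)).
  move=> r s [] /(congr1 Posz); rewrite !gE => /eqP; rewrite eqz_modDr.
  rewrite eqz_mod_dvd -mulrBr Gauss_dvdzr 1?coprimez_sym // -eqz_mod_dvd.
  by rewrite !modz_nat !modn_small // eqz_nat => /eqP/val_inj.
rewrite [RHS](reindex_inj g_inj) /=.
by apply: eq_bigr => r _; rewrite gE -periodic_modz.
Qed.

Lemma sum_periodic_mul (d : nat) :
  \sum_(r < d * q) h r%:Z = (\sum_(r < q) h r%:Z) *+ d.
Proof.
elim: d => [|d IHd]; first by rewrite mul0n big_ord0 mulr0n.
rewrite mulSnr big_split_ord /= IHd mulrSr; congr (_ + _).
by apply: eq_bigr => r _; rewrite PoszD PoszM addrC periodicMD.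
Qed.

End PeriodicSums.

(** * Raabe's multiplication formula with alternating signs *)

Section Multiplication.
Variable R : realType.
Implicit Types (x y u v w : R) (F : R -> R).

Local Notation Ep := (@Epoly R).

(** The factor q^k makes the defect Appell in k. Moving the argument from 0 to 1 shifts the
    summation index, so the comparison telescopes; because q is odd, the end term is -E_k(1), and
    the sum E_k(1) + E_k(0) appears. *)
Lemma Epoly_mult q m w : odd q ->
  \sum_(r < q) (-1) ^+ r * (Ep m).[(w + r%:R) / q%:R] = (Ep m).[w] / q%:R ^+ m.
Proof.
move=> q_odd; have q_neq0 : q%:R != 0 :> R by rewrite pnatr_eq0; case: q q_odd.
pose P (r : nat) : {poly R} := q%:R^-1 *: 'X + (r%:R / q%:R)%:P.
pose d k : {poly R} := q%:R ^+ k *: (\sum_(r < q) (-1) ^+ r *: (Ep k \Po P r)) - Ep k.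
have PE r x : (P r).[x] = (x + r%:R) / q%:R by rewrite !hornerE; field.
have dE k x : (d k).[x] =
    q%:R ^+ k * (\sum_(r < q) (-1) ^+ r * (Ep k).[(x + r%:R) / q%:R]) - (Ep k).[x].
  rewrite hornerD hornerN hornerZ horner_sum; congr (_ * _ - _).
  by apply: eq_bigr => r _; rewrite hornerZ horner_comp PE.
have d0 k : d k = 0.
  move: k; apply: (@appell_antiperiodic_eq0 _ d 0) => [|k|k].
  - rewrite /d expr0 scale1r derivB raddf_sum /= big1 ?Epoly0 ?derivC ?subr0 // => r _.
    by rewrite comp_polyC derivZ derivC scaler0.
  - rewrite /d derivB derivZ deriv_Epoly scalerBr raddf_sum /= !scaler_sumr.
    congr (_ - _); apply: eq_bigr => r _.
    rewrite derivZ deriv_comp deriv_Epoly derivD derivC addr0 derivZ derivX.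
    rewrite comp_polyZ -scalerAr mulr1 !scalerA; congr (_ *: _).
    by rewrite exprS; field.
  pose f r := (-1) ^+ r * (Ep k).[r%:R / q%:R].
  have f1 : \sum_(r < q) (-1) ^+ r * (Ep k).[(0 + 1 + r%:R) / q%:R]
      = - \sum_(r < q) f r.+1.
    rewrite -sumrN; apply: eq_bigr => r _.
    by rewrite /f exprS mulN1r mulNr opprK add0r nat1r.
  have f0 : \sum_(r < q) (-1) ^+ r * (Ep k).[(0 + r%:R) / q%:R] = \sum_(r < q) f r.
    by apply: eq_bigr => r _; rewrite add0r.
  have : \sum_(r < q) f r.+1 - \sum_(r < q) f r = - ((Ep k).[1] + (Ep k).[0]).
    rewrite -sumrB -(big_mkord xpredT (fun r => f r.+1 - f r)) telescope_sumr //.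
    by rewrite /f -signr_odd q_odd divff // mul0r expr0 expr1; ring.
  rewrite Epoly1 => e; apply/eqP; rewrite -addr_eq0 !dE f1 f0 add0r.
  move/(canRL (subrK _)): e => ->; rewrite -[X in _ + X]opprK.
  have -> : (Ep k).[1] = 2 * (k == 0%N)%:R - (Ep k).[0] by rewrite -Epoly1 addrK.
  apply/eqP; rewrite !opprD !opprK mulrDr; move: (\sum_(r < q) f r).
  by case: k {f f1 f0} => [|k] s /=; rewrite ?expr0; ring.
have := dE m w; rewrite d0 horner0 => /eqP.
rewrite eq_sym subr_eq0 => /eqP <-.
by rewrite mulrC mulKf // expf_neq0.
Qed.

Lemma oddz_absz (a : int) : (a %% 2)%Z = 1 -> odd `|a|%N.
Proof. by lia. Qed.

Definition quasiperiodic F := forall x (k : int), F (x + k%:~R) = (-1) ^ k * F x.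

Section Quasiperiodic.
Variables (F : R -> R) (q : nat).
Hypotheses (Fq : quasiperiodic F) (q_odd : odd q).

Let q_neq0 : q%:R != 0 :> R. Proof. by rewrite pnatr_eq0; case: q q_odd. Qed.
Let q_gt0 : (0 < q)%N. Proof. by case: q q_odd. Qed.

(** For odd q the sign (-1)^q cancels the one from F(x + 1) = -F(x): the summand is q-periodic in t,
    so its index may be shifted or negated modulo q. *)
Let twist u (t : int) := (-1) ^ t * F (u + t%:~R / q%:R).

Let twistD u t : twist u (t + q%:Z) = twist u t.
Proof.
rewrite /twist signzD intrD mulrDl divff // addrA -[1]/(1%:~R) Fq.
by rewrite -exprnP -signr_odd q_odd expr1 expr1z; ring.
Qed.

(** Shifting the index by -floor(q u) moves every argument to (w + r)/q with 0 <= w < 1, hence into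
    [0, 1). *)
Lemma quasiperiodic_sum_reduce u :
  \sum_(r < q) (-1) ^+ r * F (u + r%:R / q%:R) = (-1) ^ Num.floor (q%:R * u) *
  \sum_(r < q) (-1) ^+ r * F ((fracp (q%:R * u) + r%:R) / q%:R).
Proof.
set k := Num.floor _.
rewrite -[LHS]/(\sum_(r < q) twist u r%:Z).
have co1 : coprimez 1 q by rewrite coprimezE coprime1n.
rewrite -(sum_periodic_affine (twistD u) (- k) q_gt0 co1) mulr_sumr.
apply: eq_bigr => r _; rewrite mul1r /twist signzD signzN mulrA [_ * (-1) ^ k]mulrC.
congr (_ * F _); rewrite /fracp -/k intrD intrN; field.
by [].
Qed.

Lemma quasiperiodic_sum_opp u :
  \sum_(r < q) (-1) ^+ r * F (u - r%:R / q%:R)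
  = \sum_(r < q) (-1) ^+ r * F (u + r%:R / q%:R).
Proof.
rewrite -[RHS]/(\sum_(r < q) twist u r%:Z).
have co : coprimez (-1) q by rewrite coprimezE coprime1n.
rewrite -(sum_periodic_affine (twistD u) 0 q_gt0 co).
apply: eq_bigr => r _; rewrite addr0 mulN1r /twist signzN intrN mulNr; congr (_ * _).
Qed.

End Quasiperiodic.

Lemma Ebar_quasiperiodic n : quasiperiodic (Ebar n).
Proof. by move=> x k; apply: EbarD. Qed.

Lemma signZ_quasiperiodic : quasiperiodic (@signZ R).
Proof. by move=> x k; apply: signZD. Qed.

Lemma unit_grid q (r : 'I_q) w : 0 <= w < 1 -> 0 <= (w + r%:R) / q%:R < 1.
Proof.
move=> /andP[w0 w1]; have q_gt0 : 0 < q%:R :> R.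
  by rewrite ltr0n; case: q r => // -[].
rewrite divr_ge0 ?addr_ge0 ?ler0n //= ltr_pdivrMr // mul1r.
apply: lt_le_trans (_ : 1 + r%:R <= _); first by rewrite ltrD2r.
by rewrite nat1r ler_nat.
Qed.

Lemma unit_grid_eq0 q (r : 'I_q) w : 0 <= w < 1 ->
  ((w + r%:R) / q%:R == 0) = (r == 0 :> nat) && (w == 0).
Proof.
move=> /andP[w0 w1]; have q_neq0 : q%:R != 0 :> R.
  by rewrite pnatr_eq0; case: q r => // -[].
by rewrite mulf_eq0 invr_eq0 (negPf q_neq0) orbF paddr_eq0 // pnatr_eq0 andbC.
Qed.

Lemma sum_pick0 q (c : nat -> R) : (0 < q)%N ->
  \sum_(r < q) (r == 0 :> nat)%:R * c r = c 0%N.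
Proof.
case: q => // q _; rewrite big_ord_recl big1 => [|r _]; first by rewrite mul1r addr0.
by rewrite mul0r.
Qed.

Lemma Ebar_mult_nat q m u : odd q ->
  \sum_(r < q) (-1) ^+ r * Ebar m (u + r%:R / q%:R) = Ebar m (q%:R * u) / q%:R ^+ m.
Proof.
move=> q_odd; rewrite (quasiperiodic_sum_reduce (@Ebar_quasiperiodic m)) //.
set w := fracp _; have w01 : 0 <= w < 1 by apply: fracp_bounds.
rewrite [in RHS](fracpE (q%:R * u)) EbarD -/w -mulrA; congr (_ * _).
rewrite [in RHS]unit_Ebar // mulrBl -Epoly_mult //.
have -> : ((m == 0%N) && (w == 0))%:R / q%:R ^+ m = ((m == 0%N) && (w == 0))%:R :> R.
  by case: m => [|m] /=; rewrite ?divr1 ?mul0r.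
have q_gt0 := odd_gt0 q_odd.
(* Only the grid point r = 0 can be an integer, so the defect on the right is that of a single
   summand on the left. *)
have -> : ((m == 0%N) && (w == 0))%:R = \sum_(r < q)
    (r == 0 :> nat)%:R * ((-1) ^+ r * ((m == 0%N) && (w == 0))%:R) :> R.
  by rewrite (sum_pick0 (fun r => (-1) ^+ r * ((m == 0%N) && (w == 0))%:R)) // mul1r.
rewrite -sumrB; apply: eq_bigr => r _; rewrite unit_Ebar ?unit_grid // unit_grid_eq0 //.
by rewrite -!mulnb !natrM; ring.
Qed.

Lemma signZ_mult_nat q u : odd q ->
  \sum_(r < q) (-1) ^+ r * signZ (u + r%:R / q%:R) = signZ (q%:R * u).
Proof.
move=> q_odd; rewrite (quasiperiodic_sum_reduce signZ_quasiperiodic) //.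
set w := fracp _; have w01 : 0 <= w < 1 by apply: fracp_bounds.
rewrite [in RHS](fracpE (q%:R * u)) signZD -/w; congr (_ * _).
rewrite [in RHS]unit_signZ //.
have q_gt0 := odd_gt0 q_odd.
have -> : (w == 0)%:R = \sum_(r < q) (r == 0 :> nat)%:R * ((-1) ^+ r * (w == 0)%:R) :> R.
  by rewrite (sum_pick0 (fun r => (-1) ^+ r * (w == 0)%:R)) // mul1r.
apply: eq_bigr => r _; rewrite unit_signZ ?unit_grid // unit_grid_eq0 //.
by rewrite -mulnb natrM; ring.
Qed.

Lemma sum_div_int F (a : int) u : quasiperiodic F -> odd `|a|%N ->
  \sum_(r < `|a|%N) (-1) ^+ r * F (u + r%:R / a%:~R) =
  \sum_(r < `|a|%N) (-1) ^+ r * F (u + r%:R / `|a|%N%:R).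
Proof.
move=> Fq a_odd; case: a a_odd => p p_odd //.
rewrite -(quasiperiodic_sum_opp Fq p_odd); apply: eq_bigr => r _.
by rewrite [X in _ / X](_ : _ = - p.+1%:R) ?invrN ?mulrN // NegzE intrN.
Qed.

(** For negative a, the sign of a, the parity sign (-1)^(m+1) and the sign (-1)^m of a^m multiply to
    1. *)
Lemma Ebar_mult (a : int) m u : odd `|a|%N ->
  \sum_(r < `|a|%N) (-1) ^+ r * Ebar m (u + r%:R / a%:~R)
  = (Num.sg a)%:~R * Ebar m (a%:~R * u) / a%:~R ^+ m.
Proof.
move=> a_odd; rewrite sum_div_int ?Ebar_mult_nat //; last exact: Ebar_quasiperiodic.
case: a a_odd => p p_odd.
  by rewrite gtr0_sg ?mul1r // ltz_nat; case: p p_odd.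
have -> : (Num.sg (Negz p))%:~R = - 1 :> R by rewrite NegzE sgrN gtr0_sg.
have -> : (Negz p)%:~R = - p.+1%:R :> R by rewrite NegzE intrN.
rewrite [- _ * u]mulNr EbarN /=.
rewrite (exprNn p.+1%:R) invfM exprS; set s : R := (-1) ^+ m.
have -> : s^-1 = s by rewrite /s invr_sign.
by transitivity (s ^+ 2 * (Ebar m (p.+1%:R * u) / p.+1%:R ^+ m)); [rewrite sqrr_sign mul1r | ring].
Qed.

Lemma signZ_mult (a : int) u : odd `|a|%N ->
  \sum_(r < `|a|%N) (-1) ^+ r * signZ (u + r%:R / a%:~R) = signZ (a%:~R * u).
Proof.
move=> a_odd; rewrite sum_div_int ?signZ_mult_nat //; last exact: signZ_quasiperiodic.
by case: a a_odd => p // _; rewrite NegzE intrN mulNr signZN.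
Qed.

End Multiplication.

(** * Raabe's formula for signed divisors and a common factor *)

Section Reciprocity.
Variable R : realType.
Implicit Types (x y u v w : R) (F : R -> R) (a b : int).

Lemma odd_intr_neq0 a : odd `|a|%N -> a%:~R != 0 :> R.
Proof. by move=> a_odd; rewrite intr_eq0 -absz_gt0 odd_gt0. Qed.

Lemma Ebar_mult_sub a m u : odd `|a|%N ->
  \sum_(r < `|a|%N) (-1) ^+ r * Ebar m (u - r%:R / a%:~R)
  = (Num.sg a)%:~R * Ebar m (a%:~R * u) / a%:~R ^+ m.
Proof.
move=> a_odd; rewrite -Ebar_mult // sum_div_int //; last exact: Ebar_quasiperiodic.
have := @sum_div_int _ (Ebar m) (- a) u (@Ebar_quasiperiodic _ m).
rewrite abszN => <- //; apply: eq_bigr => r _.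
by rewrite intrN invrN mulrN.
Qed.

Lemma quasiperiodic_twistD F a u (t : int) : quasiperiodic F -> odd `|a|%N ->
  (-1) ^ (t + `|a|%N%:Z) * F (u + (t + `|a|%N%:Z)%:~R / a%:~R)
  = (-1) ^ t * F (u + t%:~R / a%:~R).
Proof.
move=> Fq a_odd; have a_neq0 := odd_intr_neq0 a_odd.
have -> : (t + `|a|%N%:Z)%:~R / a%:~R = t%:~R / a%:~R + (Num.sg a)%:~R :> R.
  by rewrite intrD mulrDl abszE normrEsg intrM mulfK.
rewrite addrA Fq signzD -exprnP -signr_odd a_odd expr1.
have -> : (-1 : R) ^ Num.sg a = -1.
  by rewrite expN1r absz_sg; case: eqP a_odd => [->|].
by ring.
Qed.

(** With d = gcd(a, b), a = a' d and b = b' d, the argument is w + a' s/b', and (-1)^s = (-1)^(a' s)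
    because a' is odd. The summand is thus a |b'|-periodic function of a' s; the sum covers d
    periods, a' permutes the residues, and Raabe's formula for b' applies. The power of d comes from
    d/b'^N = d^(N+1)/b^N. *)
Lemma Ebar_mult_gcd N a b y z : odd `|a|%N -> odd `|b|%N ->
  \sum_(s < `|b|%N) (-1) ^+ s * Ebar N (a%:~R * (s%:R + z) / b%:~R - y)
  = (Num.sg b)%:~R * (gcdz a b)%:~R ^+ N.+1 / b%:~R ^+ N
    * Ebar N ((a%:~R * z - b%:~R * y) / (gcdz a b)%:~R).
Proof.
move=> a_odd b_odd; have b_neq0 := odd_intr_neq0 b_odd.
have d_gt0 : (0 < gcdn `|a| `|b|)%N by rewrite gcdn_gt0 odd_gt0.
have da : (gcdz a b %| a)%Z by apply: dvdz_gcdl.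
have db : (gcdz a b %| b)%Z by apply: dvdz_gcdr.
move: d_gt0 da db; rewrite /gcdz.
have [d dE] : exists d, d = gcdn `|a| `|b| by exists (gcdn `|a| `|b|).
rewrite -dE => d_gt0 /dvdzP[a' aE] /dvdzP[b' bE].
have co : coprime `|a'| `|b'|.
  by rewrite /coprime -(eqn_pmul2r d_gt0) mul1n muln_gcdl {3}dE aE bE !abszM.
have dR_neq0 : d%:R != 0 :> R by rewrite pnatr_eq0 -lt0n.
have [a'_odd b'_odd] : odd `|a'|%N /\ odd `|b'|%N.
  by move: a_odd b_odd; rewrite aE bE !abszM !oddM => /andP[-> _] /andP[-> _].
have b'_neq0 := odd_intr_neq0 b'_odd.
pose w := (a%:~R * z - b%:~R * y) / b%:~R.
pose g (t : int) := (-1) ^ t * Ebar N (w + t%:~R / b'%:~R).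
have gD t : g (t + `|b'|%N%:Z) = g t.
  by apply: quasiperiodic_twistD => //; apply: Ebar_quasiperiodic.
pose h (t : int) := g (a' * t + 0).
have hD t : h (t + `|b'|%N%:Z) = h t.
  by rewrite /h !addr0 mulrDr periodicMD.
have hE (s : nat) : h s%:Z = (-1) ^+ s * Ebar N (a%:~R * (s%:R + z) / b%:~R - y).
  rewrite /h /g addr0; congr (_ * Ebar N _).
    by rewrite expN1r abszM -signr_odd oddM a'_odd /= signr_odd.
  rewrite /w aE bE !intrM; field.
  by rewrite dR_neq0.
under eq_bigr => s _ do rewrite -hE.
have -> : `|b|%N = (d * `|b'|)%N by rewrite bE abszM mulnC.
rewrite (sum_periodic_mul hD) (sum_periodic_affine gD 0 (odd_gt0 b'_odd) co).
rewrite -[X in X *+ d]/(\sum_(r < `|b'|) (-1) ^+ r * Ebar N (w + r%:R / b'%:~R)).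
rewrite Ebar_mult // -mulr_natr.
have -> : b'%:~R * w = (a%:~R * z - b%:~R * y) / d%:~R.
  by rewrite /w bE intrM; field; rewrite dR_neq0.
have -> : Num.sg b' = Num.sg b.
  by rewrite bE sgrM (@gtr0_sg _ d%:Z) ?mulr1 // ltz_nat.
have -> : b%:~R = b'%:~R * d%:R :> R by rewrite bE intrM.
rewrite exprMn exprS; field.
by rewrite !expf_neq0.
Qed.

End Reciprocity.

(** * From grid sums to Hardy-Berndt sums *)

Section Reciprocity.
Variable R : realType.
Implicit Types (x y z u v w : R) (F : R -> R) (a b : int).

(* Summed over the grid, each S5 term of the case a = b = 1 becomes a Hardy-Berndt sum. *)
Lemma sum_Ebar_Bbar_S5 (s N : nat) (c : nat -> R) a b x y z :
  odd `|a|%N -> odd `|b|%N ->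
  \sum_(r < `|a|%N) \sum_(t < `|b|%N) (-1) ^+ r * (-1) ^+ t *
    \sum_(j < s) c j * (Ebar j (((z + t%:R) / b%:~R - x) - ((y + r%:R) / a%:~R - x))
      * Bbar (N - j) ((z + t%:R) / b%:~R - x))
  = (Num.sg a)%:~R * \sum_(j < s) c j / a%:~R ^+ j * S5 j (N - j) a 1 b y x z.
Proof.
move=> a_odd b_odd; have a_neq0 := odd_intr_neq0 R a_odd.
have b_neq0 := odd_intr_neq0 R b_odd.
under eq_bigr => r _ do under eq_bigr => t _ do rewrite mulr_sumr.
under eq_bigr => r _ do rewrite exchange_big /=.
rewrite exchange_big /= mulr_sumr; apply: eq_bigr => j _.
rewrite exchange_big /= /S5 !mulr_sumr; apply: eq_bigr => t _.
set v := _ - x; have -> : (1%:~R * (t%:R + z) / b%:~R - x) = v by rewrite /v; field.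
(* Only the Euler factor depends on r, so the sum over r collapses by Raabe's formula and leaves a
   sum over t modulo |b|. *)
transitivity ((-1) ^+ t * c j * Bbar (N - j) v *
  \sum_(r < `|a|%N) (-1) ^+ r * Ebar j ((v - (y / a%:~R - x)) - r%:R / a%:~R)).
  rewrite mulr_sumr; apply: eq_bigr => r _.
  have -> : v - ((y + r%:R) / a%:~R - x) = v - (y / a%:~R - x) - r%:R / a%:~R by field.
  by ring.
rewrite Ebar_mult_sub //.
have -> : a%:~R * (v - (y / a%:~R - x)) = a%:~R * (t%:R + z) / b%:~R - y.
  by rewrite /v; field; rewrite a_neq0 b_neq0.
by ring.
Qed.

Lemma expr_subn_ord x m (j : 'I_m.+1) : x != 0 -> x ^+ (m - j) = x ^+ m / x ^+ j.
Proof.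
move=> x_neq0; have := congr1 (fun k => x ^+ k) (subnK (ltnSE (ltn_ord j))).
by rewrite exprD => <-; rewrite mulfK ?expf_neq0.
Qed.

Lemma sgr_sqr_odd a : odd `|a|%N -> (Num.sg a)%:~R * (Num.sg a)%:~R = 1 :> R.
Proof. by case: a => [[|p]|p] //= _; rewrite -intrM. Qed.

End Reciprocity.

(** * The reciprocity formula *)

Unset Implicit Arguments.

Theorem theorem1p1 (R : realType) (m n : nat) (a b : int)
  (ha : (a %% 2)%Z = 1) (hb : (b %% 2)%Z = 1) (x y z : R) :
  2 * (b%:~R) ^+ n * (Num.sg b)%:~R *
    (\sum_(j < m.+1) 'C(m, j)%:R * (-1) ^+ j * (a%:~R) ^+ (m - j)
        / (m + n + 1 - j)%:R * S5 j (m + n + 1 - j) a 1 b y x z)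
  + 2 * (a%:~R) ^+ m * (Num.sg a)%:~R *
    (\sum_(j < n.+1) 'C(n, j)%:R * (-1) ^+ j * (b%:~R) ^+ (n - j)
        / (m + n + 1 - j)%:R * S5 j (m + n + 1 - j) b 1 a z x y)
  = (-1) ^+ (m + n) * Ebar m (a%:~R * x - y) * Ebar n (b%:~R * x - z)
    + ((m == 0%N) && (n == 0%N))%:R * (Num.sg (a * b))%:~R
        * (-1) ^ (Num.floor (a%:~R * x + b%:~R * x - y - z))
        * deltaZ (a%:~R * x - y) * deltaZ (b%:~R * x - z)
    + (-1) ^+ m * 2 * (m`!)%:R * (n`!)%:R * ((gcdz a b)%:~R) ^+ (m + n + 2)
        / ((a%:~R) ^+ (n + 1) * (b%:~R) ^+ (m + 1) * ((m + n + 1)`!)%:R)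
        * Ebar (m + n + 1) ((a%:~R * z - b%:~R * y) / (gcdz a b)%:~R).
Proof.
have a_odd := oddz_absz ha; have b_odd := oddz_absz hb.
have a_neq0 := odd_intr_neq0 R a_odd; have b_neq0 := odd_intr_neq0 R b_odd.
have a_sg := sgr_sqr_odd R a_odd; have b_sg := sgr_sqr_odd R b_odd.
pose u (r : nat) : R := (y + r%:R) / a%:~R - x.
pose v (t : nat) : R := (z + t%:R) / b%:~R - x.
pose N := (m + n).+1.
pose G (f : nat -> nat -> R) :=
  \sum_(r < `|a|%N) \sum_(t < `|b|%N) (-1) ^+ r * (-1) ^+ t * f r t.
have GM (f g : nat -> R) (c : R) : G (fun r t => c * f r * g t)
    = c * (\sum_(r < `|a|%N) (-1) ^+ r * f r) * (\sum_(t < `|b|%N) (-1) ^+ t * g t).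
  rewrite -mulrA mulr_suml mulr_sumr; apply: eq_bigr => r _; rewrite mulrA mulr_sumr.
  by apply: eq_bigr => t _; ring.
have GD f g : G (fun r t => f r t + g r t) = G f + G g.
  rewrite -big_split; apply: eq_bigr => r _; rewrite -big_split.
  by apply: eq_bigr => t _ /=; ring.
have GZ (c : R) f : G (fun r t => c * f r t) = c * G f.
  rewrite mulr_sumr; apply: eq_bigr => r _; rewrite mulr_sumr.
  by apply: eq_bigr => t _ /=; ring.
have Ga (c : nat -> R) : G (fun r t =>
    \sum_(j < m.+1) c j * (Ebar j (v t - u r) * Bbar (N - j) (v t)))
  = (Num.sg a)%:~R * \sum_(j < m.+1) c j / a%:~R ^+ j * S5 j (N - j) a 1 b y x z.
  by rewrite -(sum_Ebar_Bbar_S5 _ _ _ _ _ _ a_odd b_odd).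
have Gb (c : nat -> R) : G (fun r t =>
    \sum_(j < n.+1) c j * (Ebar j (u r - v t) * Bbar (N - j) (u r)))
  = (Num.sg b)%:~R * \sum_(j < n.+1) c j / b%:~R ^+ j * S5 j (N - j) b 1 a z x y.
  rewrite -(sum_Ebar_Bbar_S5 _ _ _ _ _ _ b_odd a_odd) [RHS]exchange_big.
  by apply: eq_bigr => r _; apply: eq_bigr => t _; rewrite [_ ^+ r * _]mulrC.
have au r : u r = (y / a%:~R - x) + r%:R / a%:~R by rewrite /u; field.
have bv t : v t = (z / b%:~R - x) + t%:R / b%:~R by rewrite /v; field.
have auE : a%:~R * (y / a%:~R - x) = - (a%:~R * x - y) by field.
have bvE : b%:~R * (z / b%:~R - x) = - (b%:~R * x - z) by field.
have GEE : G (fun r t => 1 * Ebar m (u r) * Ebar n (v t))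
  = (-1) ^+ (m + n) * (Num.sg a)%:~R * (Num.sg b)%:~R * Ebar m (a%:~R * x - y)
     * Ebar n (b%:~R * x - z) / (a%:~R ^+ m * b%:~R ^+ n).
  rewrite GM.
  under eq_bigr => r _ do rewrite au.
  rewrite Ebar_mult // auE EbarN.
  under eq_bigr => t _ do rewrite bv.
  rewrite Ebar_mult // bvE EbarN !exprS exprD; field.
  by rewrite !expf_neq0.
have Gsign c : G (fun r t => c * signZ (u r) * signZ (v t))
  = c * (-1) ^ (Num.floor (a%:~R * x + b%:~R * x - y - z))
        * deltaZ (a%:~R * x - y) * deltaZ (b%:~R * x - z).
  rewrite GM.
  under eq_bigr => r _ do rewrite au.
  rewrite signZ_mult // auE signZN.
  under eq_bigr => t _ do rewrite bv.
  rewrite signZ_mult // bvE signZN /signZ /deltaZ.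
  case: ifP => [|_]; last by rewrite !(mulr0, mul0r).
  move=> a_int; case: ifP => [_|_]; last by rewrite !(mulr0, mul0r).
  (* As ax - y is an integer here, the floor of the sum splits and the sign factors. *)
  have -> : a%:~R * x + b%:~R * x - y - z = (b%:~R * x - z) + (a%:~R * x - y) by ring.
  by rewrite (floorDrz _ a_int) signzD; ring.
have GN : G (fun r t => Ebar N (v t - u r))
  = (Num.sg a)%:~R * (Num.sg b)%:~R * (gcdz a b)%:~R ^+ N.+1 / (a%:~R ^+ N * b%:~R ^+ N)
    * Ebar N ((a%:~R * z - b%:~R * y) / (gcdz a b)%:~R).
  transitivity ((Num.sg a)%:~R / a%:~R ^+ N * \sum_(t < `|b|%N)
      (-1) ^+ t * Ebar N (a%:~R * (t%:R + z) / b%:~R - y)).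
    rewrite /G exchange_big mulr_sumr; apply: eq_bigr => t _.
    transitivity ((-1) ^+ t * \sum_(r < `|a|%N)
        (-1) ^+ r * Ebar N ((v t - (y / a%:~R - x)) - r%:R / a%:~R)).
      rewrite mulr_sumr; apply: eq_bigr => r _.
      have -> : v t - u r = v t - (y / a%:~R - x) - r%:R / a%:~R by rewrite au; ring.
      by ring.
    rewrite Ebar_mult_sub //.
    have -> : a%:~R * (v t - (y / a%:~R - x)) = a%:~R * (t%:R + z) / b%:~R - y.
      by rewrite /v; field; rewrite a_neq0 b_neq0.
    by ring.
  rewrite Ebar_mult_gcd //; field.
  by rewrite !expf_neq0.
have : G (fun r t => 1 * Ebar m (u r) * Ebar n (v t)
    + ((m == 0%N) && (n == 0%N))%:R * signZ (u r) * signZ (v t)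
    + (-1) ^+ m * 2 * m`!%:R * n`!%:R / N`!%:R * Ebar N (v t - u r))
  = G (fun r t => 2 * (\sum_(j < m.+1) 'C(m, j)%:R * (-1) ^+ j / (N - j)%:R
           * (Ebar j (v t - u r) * Bbar (N - j) (v t)))
       + 2 * (\sum_(j < n.+1) 'C(n, j)%:R * (-1) ^+ j / (N - j)%:R
           * (Ebar j (u r - v t) * Bbar (N - j) (u r)))).
  apply: eq_bigr => r _; apply: eq_bigr => t _; congr (_ * _).
  by rewrite mul1r; apply: bar_product.
rewrite !GD !GZ GEE Gsign GN.
rewrite (Ga (fun j => 'C(m, j)%:R * (-1) ^+ j / (N - j)%:R)).
rewrite (Gb (fun j => 'C(n, j)%:R * (-1) ^+ j / (N - j)%:R)) => e.
have -> : \sum_(j < m.+1) 'C(m, j)%:R * (-1) ^+ j * a%:~R ^+ (m - j)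
        / (m + n + 1 - j)%:R * S5 j (m + n + 1 - j) a 1 b y x z
  = a%:~R ^+ m * \sum_(j < m.+1) 'C(m, j)%:R * (-1) ^+ j / (N - j)%:R / a%:~R ^+ j
     * S5 j (N - j) a 1 b y x z.
  rewrite mulr_sumr addn1; apply: eq_bigr => j _.
  by rewrite (expr_subn_ord _ a_neq0); ring.
have -> : \sum_(j < n.+1) 'C(n, j)%:R * (-1) ^+ j * b%:~R ^+ (n - j)
        / (m + n + 1 - j)%:R * S5 j (m + n + 1 - j) b 1 a z x y
  = b%:~R ^+ n * \sum_(j < n.+1) 'C(n, j)%:R * (-1) ^+ j / (N - j)%:R / b%:~R ^+ j
     * S5 j (N - j) b 1 a z x y.
  rewrite mulr_sumr addn1; apply: eq_bigr => j _.
  by rewrite (expr_subn_ord _ b_neq0); ring.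
move: e; set Sa := \sum_(j < m.+1) _; set Sb := \sum_(j < n.+1) _; move=> e.
(* The grid identity is scaled by sgn(a) sgn(b) a^m b^n; in each sum one sign occurs twice and
   disappears. *)
transitivity ((Num.sg a)%:~R * (Num.sg b)%:~R * a%:~R ^+ m * b%:~R ^+ n *
  (2 * ((Num.sg a)%:~R * Sa) + 2 * ((Num.sg b)%:~R * Sb))).
  transitivity (2 * b%:~R ^+ n * (Num.sg b)%:~R * (a%:~R ^+ m * Sa)
      * ((Num.sg a)%:~R * (Num.sg a)%:~R)
    + 2 * a%:~R ^+ m * (Num.sg a)%:~R * (b%:~R ^+ n * Sb) * ((Num.sg b)%:~R * (Num.sg b)%:~R)).
    by rewrite a_sg b_sg !mulr1.
  by ring.
rewrite -{}e sgrM intrM !addn1 addn2 -/N !mulrDr.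
have Am : a%:~R ^+ N = a%:~R ^+ m * a%:~R ^+ n.+1 :> R by rewrite -exprD addnS.
have Bn : b%:~R ^+ N = b%:~R ^+ n * b%:~R ^+ m.+1 :> R by rewrite -exprD addnS addnC.
have Am0 : a%:~R ^+ m != 0 :> R by rewrite expf_neq0.
have An0 : a%:~R ^+ n.+1 != 0 :> R by rewrite expf_neq0.
have Bm0 : b%:~R ^+ m.+1 != 0 :> R by rewrite expf_neq0.
have Bn0 : b%:~R ^+ n != 0 :> R by rewrite expf_neq0.
have N0 : N`!%:R != 0 :> R by rewrite pnatr_eq0 -lt0n fact_gt0.
(* [field] does not know that the squares of the signs are 1, so they are inserted on the right to
   match the left. *)
have sg4 (t : R) : t = (Num.sg a)%:~R * (Num.sg a)%:~R
    * ((Num.sg b)%:~R * (Num.sg b)%:~R) * t by rewrite a_sg b_sg !mul1r.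
rewrite Am Bn; congr (_ + _ + _).
- rewrite [RHS]sg4.
  move: Am0 Bn0; move: (a%:~R ^+ m) (b%:~R ^+ n) => A B A0 B0; field.
  by rewrite A0 B0.
- have [m0|_] := eqVneq m 0%N; last by rewrite !mul0r mulr0.
  have [n0|_] := eqVneq n 0%N; last by rewrite !mul0r mulr0.
  by rewrite m0 n0 !expr0; ring.
rewrite [RHS]sg4.
move: Am0 Bn0 An0 Bm0 N0.
move: (a%:~R ^+ m) (b%:~R ^+ n) (a%:~R ^+ n.+1) (b%:~R ^+ m.+1) N`!%:R.
move=> A B A' B' M A0 B0 A'0 B'0 M0; field.
by rewrite M0 B'0 A'0 B0 A0.
Qed.
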